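(* Let $\vec G$ be a directed graph on a linearly ordered set of edges $E$, with $\iota$ dual-active edges and $\varepsilon$ active edges, and underlying graph $G$. The $2^{\iota+\varepsilon}$ orientations of $G$ obtained by reorienting any union of parts of the active partition of $\vec G$ have the same active filtration and active partition as $\vec G$ (and hence also the same active and dual-active edges, and the same active minors up to taking the opposite).
   Context: Graphs are finite, may have loops and multiple edges, and are connected unless they arise as minors (isolated vertices are ignored). For $F\subseteq E$, $\vec G(F)$ is the restriction to $F$ (deletion of $E\setminus F$) and $\vec G/F$ the contraction of $F$. Cycles and cocycles (inclusion-minimal non-empty edge cuts) are edge subsets. A cycle is directed if its edges are consistently oriented along it; a cocycle is directed if all its edges go from one side of the cut to the other. Reorienting a set of edges means reversing the direction of each of them; the opposite of a digraph is obtained by reversing all edges. $\subset$ denotes strict inclusion. Dual-active edges $a_1<\cdots<a_\iota$ of $\vec G$ are the smallest edges of directed cocycles, active edges $a'_1<\cdots<a'_\varepsilon$ the smallest edges of directed cycles. The active filtration of $\vec G$ is $\emptyset=F'_\varepsilon\subset\cdots\subset F'_0=F_c=F_0\subset\cdots\subset F_\iota=E$, where $F_c$ is the union of all directed cycles, $F_k=E\setminus\bigcup\{D\text{ directed cocycle}:\min(D)\ge a_{k+1}\}$ for $0\le k\le\iota-1$, and $F'_k=\bigcup\{C\text{ directed cycle}:\min(C)\ge a'_{k+1}\}$ for $0\le k\le\varepsilon-1$. The active partition of $\vec G$ is the partition of $E$ into the parts $F_k\setminus F_{k-1}$ ($1\le k\le\iota$) and $F'_{k-1}\setminus F'_k$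 ($1\le k\le\varepsilon$), given together with $F_c$. The active minors are $\vec G(F_k)/F_{k-1}$ ($1\le k\le\iota$) and $\vec G(F'_{k-1})/F'_k$ ($1\le k\le\varepsilon$). *)

(* Defs.v *)
From mathcomp Require Import all_boot all_order.

Set Implicit Arguments.
Unset Strict Implicit.
Unset Printing Implicit Defensive.

Import Order.TTheory.

(* Finite multigraphs with loops.  An edge [e] has two half-edges [(e, false)]
   and [(e, true)], attached at [ends e false] and [ends e true].  The edge set
   is a subset of the ambient type [E], so that minors of a graph on [E] are
   again graphs on [E]; the values of [ends] outside [edges] are irrelevant. *)
Record graph (V E : finType) := Graph {
  edges : {set E};
  ends : E -> bool -> V
}.

(* [e] is directed from [ends e (dir e)] to [ends e (~~ dir e)].  In particular
   a loop has two distinct orientations, and a graph has 2^|edges|; the values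
   of [dir] outside [edges] are irrelevant. *)
Record digraph (V E : finType) := Digraph {
  ugraph :> graph V E;
  dir : {ffun E -> bool}
}.

Section Graphs.
Variables V E : finType.
Implicit Types (G : graph V E) (D : digraph V E) (X : {set V}) (A F : {set E}).

Definition adj G : rel V :=
  [rel u v | [exists e in edges G, [exists b : bool,
     (ends G e b == u) && (ends G e (~~ b) == v)]]].

Definition connected G : Prop := forall u v : V, connect (adj G) u v.

Definition tail D (e : E) : V := ends D e (dir D e).
Definition head D (e : E) : V := ends D e (~~ dir D e).

(* [(e, b)] is the step along [e] from [ends e b] to [ends e (~~ b)];
   [traverses G C c] says that [c] goes exactly once around a closed walk
   with pairwise distinct vertices and edges, whose edge set is [C]. *)
Definition traverses G (C : {set E}) (c : seq (E * bool)) : bool :=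
  [&& c != [::],
      all [pred s | s.1 \in edges G] c,
      cycle [rel s t | ends G s.1 (~~ s.2) == ends G t.1 t.2] c,
      uniq [seq ends G s.1 s.2 | s <- c],
      uniq [seq s.1 | s <- c] &
      C == [set e in [seq s.1 | s <- c]]].

(* A sequence with distinct edges has length at most #|E|, so the bound on its
   length only serves to make the predicate boolean. *)
Definition directed_cycle D (C : {set E}) : bool :=
  [exists n : 'I_#|E|.+1, [exists c : n.-tuple (E * bool),
     traverses D C c && all [pred s | s.2 == dir D s.1] c]].

Definition cut G X : {set E} :=
  [set e in edges G | (ends G e false \in X) != (ends G e true \in X)].

Definition is_cocycle G (B : {set E}) : bool :=
  minset [pred B' : {set E} | (B' != set0) && [exists X, B' == cut G X]] B.

Definition directed_cocycle D (B : {set E}) : bool :=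
  is_cocycle D B &&
  [exists X, (B == cut D X) &&
     [forall e in B, (tail D e \in X) && (head D e \notin X)]].

Definition reorient D A : digraph V E :=
  Digraph (ugraph D) [ffun e => (e \in A) (+) dir D e].

Definition opposite D : digraph V E := reorient D (edges D).

Definition same_digraph D D' : Prop :=
  edges D = edges D' /\
  {in edges D, forall e, ends D e =1 ends D' e /\ dir D e = dir D' e}.

Definition restrict D F : digraph V E :=
  Digraph (Graph (edges D :&: F) (ends D)) (dir D).

Definition component D F (v : V) : {set V} :=
  [set w | connect (adj (restrict D F)) v w].

(* The vertices of the contraction are the components of [restrict D F]; the
   elements of [{set V}] which are not components are isolated vertices. *)
Definition contract D F : digraph {set V} E :=
  Digraph (Graph (edges D :\: F) (fun e b => component D F (ends D e b)))
          (dir D).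

End Graphs.

Section Activities.
Variables (d : Order.disp_t) (V : finType) (E : finOrderType d).
Implicit Types (D : digraph V E) (B C : {set E}) (a m : E).

Definition is_min C m : bool := (m \in C) && [forall e in C, (m <= e)%O].

Definition min_ge C a : bool := [exists m, is_min C m && (a <= m)%O].

Definition dual_active D : seq E :=
  sort <=%O (enum [set a | [exists B, directed_cocycle D B && is_min B a]]).

Definition active D : seq E :=
  sort <=%O (enum [set a | [exists C, directed_cycle D C && is_min C a]]).

Definition dual_activity D : nat := size (dual_active D).
Definition activity D : nat := size (active D).

Definition cyclic_part D : {set E} := \bigcup_(C | directed_cycle D C) C.

(* [F_k] for k <= dual_activity D.  Indices of [dual_active] and [active] start
   at 0, so that a_(k+1) is at index k; the default value of [nth] gives the
   last term of each sequence, F_iota = E and F'_epsilon = 0. *)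
Definition dual_filtration D (k : nat) : {set E} :=
  nth (edges D)
    [seq edges D :\: \bigcup_(B | directed_cocycle D B && min_ge B a) B
       | a <- dual_active D] k.

(* [F'_k] for k <= activity D. *)
Definition cyclic_filtration D (k : nat) : {set E} :=
  nth set0
    [seq \bigcup_(C | directed_cycle D C && min_ge C a) C | a <- active D] k.

(* ((F'_0, ..., F'_epsilon), F_c, (F_0, ..., F_iota)) *)
Definition active_filtration D : seq {set E} * {set E} * seq {set E} :=
  (mkseq (cyclic_filtration D) (activity D).+1,
   cyclic_part D,
   mkseq (dual_filtration D) (dual_activity D).+1).

Definition active_parts D : {set {set E}} :=
  [set dual_filtration D k.+1 :\: dual_filtration D k
     | k : 'I_(dual_activity D)]
  :|: [set cyclic_filtration D k :\: cyclic_filtration D k.+1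
     | k : 'I_(activity D)].

Definition active_partition D : {set {set E}} * {set E} :=
  (active_parts D, cyclic_part D).

Definition dual_active_minor D (k : nat) : digraph {set V} E :=
  contract (restrict D (dual_filtration D k.+1)) (dual_filtration D k).

Definition cyclic_active_minor D (k : nat) : digraph {set V} E :=
  contract (restrict D (cyclic_filtration D k)) (cyclic_filtration D k.+1).

End Activities.

Definition same_up_to_opposite (V E : finType) (D D' : digraph V E) : Prop :=
  same_digraph D D' \/ same_digraph D (opposite D').

(* Main.v *)
From mathcomp Require Import all_boot all_order.
Require Import Defs.

Set Implicit Arguments.
Unset Strict Implicit.
Unset Printing Implicit Defensive.

Import Order.TTheory.

(** For an edge a, let U_a be the union of the directed cocycles with all edges
    at least a, and W_a the union of the directed cycles with all edges at
    least a.  The active filtration is read off from these two decreasing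
    families: a is dual-active when a is in U_a, active when a is in W_a, and
    apart from the empty set, E and the union of all directed cycles the
    filtration consists of the complements of the U_a with a dual-active and of
    the W_a with a active.  So it suffices that reorienting a union of parts
    preserves every U_b and every W_b.

    Both families are described by connectivity in a relation on the vertices.
    An edge at least a is in W_a when it joins two vertices of one strong
    component of the digraph of all such edges ([mem_cyclic_above]).  An edge is in U_a
    when it joins distinct strong components of the digraph obtained by letting
    every edge smaller than a be used in both directions
    ([mem_cocyclic_above]): the vertices reachable from the head of the edge
    are then one side of a directed cut, and such a cut contains a directed
    cocycle through any of its edges.

    Reversing U_a leaves the strong components of the second digraph untouched,
    as it only reverses edges between them; reversing W_a turns all the walks
    inside a strong component of the first digraph around.  From this follow
    inclusions between the families before and after, in one direction for
    each family.  The reversed set is again the member of index a in the family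
    of the new digraph, and reversing is an involution, so the inclusions hold
    in the other direction as well ([same_unions_reorient_cocyclic],
    [same_unions_reorient_cyclic]).

    Finally a part of the active partition is the difference of two consecutive
    members of one of the families, so it is reversed by reversing these two
    members, and a union of parts is reversed one part at a time.  The parts
    are disjoint and nonempty and there are as many as active and dual-active
    edges, which gives the number of orientations; on an active minor the
    reorientation is all or nothing, because its edges form one part. *)

Section Unions.
Variables (d : Order.disp_t) (V : finType) (E : finOrderType d).
Implicit Types (D : digraph V E) (A B C P : {set E}) (X Y Z : {set V}).
Implicit Types (a b e f : E).

(** * Directed cuts and directed cocycles *)

Definition cocyclic_above D a : {set E} :=
  \bigcup_(B | directed_cocycle D B && min_ge B a) B.

Definition cyclic_above D a : {set E} :=
  \bigcup_(C | directed_cycle D C && min_ge C a) C.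

Definition arc_above D a : rel V :=
  [rel u v | [exists e in edges D,
     [&& (a <= e)%O, tail D e == u & head D e == v]]].

(** Edges smaller than [a] can be used both ways, so a set of vertices closed
    under this relation is bounded by a directed cut with all edges at least
    [a]. *)
Definition arc_relaxed D a : rel V :=
  [rel u v | [exists e in edges D,
     ((tail D e == u) && (head D e == v))
     || [&& (e < a)%O, head D e == u & tail D e == v]]].

Lemma exists_min C e : e \in C -> exists m, is_min C m.
Proof.
move=> eC; case: (arg_minP id eC) => m mC m_min; exists m; apply/andP; split=> //.
by apply/forall_inP => f; apply: m_min.
Qed.

Lemma min_geE C a e : e \in C -> min_ge C a = [forall f in C, (a <= f)%O].
Proof.
move=> eC; apply/existsP/forall_inP => [[m /andP[/andP[_ /forall_inP mC] am]] f|].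
  by move/mC; apply: le_trans.
move=> aC; have [m m_min] := exists_min eC; exists m; rewrite m_min aC //.
by case/andP: m_min.
Qed.

Lemma mem_cut D X e :
  (e \in cut D X) = (e \in edges D) && ((tail D e \in X) != (head D e \in X)).
Proof.
rewrite inE /tail /head; by case: (dir D e); rewrite //= eq_sym.
Qed.

Definition out_cut D X : bool :=
  [forall e in edges D, (head D e \in X) ==> (tail D e \in X)].

Lemma out_cutP D X : reflect
  (forall e, e \in edges D -> head D e \in X -> tail D e \in X) (out_cut D X).
Proof.
by apply: (iffP forall_inP) => H e eD; [exact/implyP/H | apply/implyP/H].
Qed.

(** The minimality assumed here is among directed cuts, whereas a cocycle is
    minimal among all cuts.  If the cut of [Y] were strictly smaller, then
    intersecting or joining [X] with [Y] or its complement would give smaller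
    directed cuts. *)
Lemma minimal_out_cut_is_cocycle D X e :
    out_cut D X -> e \in cut D X ->
    (forall Y, out_cut D Y -> e \in cut D Y -> cut D Y \subset cut D X ->
       cut D Y = cut D X) ->
  directed_cocycle D (cut D X).
Proof.
move=> /out_cutP outX eX minX.
have dirX f : f \in cut D X -> (tail D f \in X) && (head D f \notin X).
  rewrite mem_cut => /andP[fD]; have := outX f fD.
  by case: (tail D f \in X); case: (head D f \in X) => // ->.
apply/andP; split; last first.
  by apply/existsP; exists X; rewrite eqxx; apply/forall_inP.
apply/minsetP; split=> [|B' /andP[B'0 /existsP[Y /eqP defB']] sB'X].
  by apply/andP; split; [apply/set0Pn; exists e | apply/existsP; exists X].
move: B'0 sB'X; rewrite {}defB' => B'0 sYX.
have crossY f : f \in edges D -> (tail D f \in X) = (head D f \in X) ->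
    (tail D f \in Y) = (head D f \in Y).
  move=> fD eqX; have : f \notin cut D Y.
    by apply: contra (subsetP sYX f) _; rewrite mem_cut eqX eqxx andbF.
  by rewrite mem_cut fD negbK => /eqP.
have /andP[teX heX] := dirX e eX.
have eD : e \in edges D by move: eX; rewrite mem_cut => /andP[].
(* The edges of the cut whose tail is on the same side of Y as the tail of e
   form an outgoing cut, and so do those whose head is on the same side of Y as
   the head of e; minimality says that these are all the edges. *)
have tailY f : f \in cut D X -> (tail D f \in Y) = (tail D e \in Y).
  move=> fX; have /andP[tfX hfX] := dirX f fX.
  pose Z := [set v in X | (v \in Y) == (tail D e \in Y)].
  have ZX g : g \in edges D -> (tail D g \in X) = (head D g \in X) ->
      (tail D g \in Z) = (head D g \in Z).
    by move=> gD eqX; rewrite !inE (crossY g gD eqX) eqX.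
  have /setP/(_ f) : cut D Z = cut D X.
    apply: minX.
    - apply/out_cutP => g gD hgZ; move: (hgZ); rewrite inE => /andP[hgX _].
      by rewrite ZX // hgX outX.
    - by rewrite mem_cut eD !inE teX (negPf heX) eqxx.
    - apply/subsetP => g; rewrite !mem_cut => /andP[gD]; rewrite gD.
      by apply: contraNneq => /(ZX g gD)->.
  rewrite fX mem_cut !inE tfX (negPf hfX) /=.
  by rewrite eqbF_neg negbK => /andP[_ /eqP].
have headY f : f \in cut D X -> (head D f \in Y) = (head D e \in Y).
  move=> fX; have /andP[tfX hfX] := dirX f fX.
  pose Z := [set v | (v \in X) || ((v \in Y) != (head D e \in Y))].
  have ZX g : g \in edges D -> (tail D g \in X) = (head D g \in X) ->
      (tail D g \in Z) = (head D g \in Z).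
    by move=> gD eqX; rewrite !inE (crossY g gD eqX) eqX.
  have /setP/(_ f) : cut D Z = cut D X.
    apply: minX.
    - apply/out_cutP => g gD hgZ; have [tgX|tgX] := boolP (tail D g \in X).
        by rewrite inE tgX.
      rewrite ZX // (negPf tgX); apply/esym; apply: contraNF tgX; exact: outX.
    - by rewrite mem_cut eD !inE teX (negPf heX) eqxx.
    - apply/subsetP => g; rewrite !mem_cut => /andP[gD]; rewrite gD.
      by apply: contraNneq => /(ZX g gD)->.
  rewrite fX mem_cut !inE tfX (negPf hfX) /=.
  by rewrite negbK => /andP[_ /eqP].
have eY : e \in cut D Y.
  have /set0Pn[f fY] := B'0; have fX := subsetP sYX f fY.
  by move: fY; rewrite !mem_cut eD tailY ?headY // => /andP[].
apply/eqP; rewrite eqEsubset sYX; apply/subsetP => f fX.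
move: eY; rewrite !mem_cut tailY ?headY // => /andP[_ ->].
by move: fX; rewrite mem_cut => /andP[->].
Qed.

Lemma out_cut_cocycle D X e : out_cut D X -> e \in cut D X ->
  exists2 B, directed_cocycle D B & (e \in B) && (B \subset cut D X).
Proof.
move=> outX eX.
pose P Y := [&& out_cut D Y, e \in cut D Y & cut D Y \subset cut D X].
have PX : P X by rewrite /P outX eX subxx.
case: (@arg_minnP _ X P (fun Y => #|cut D Y|) PX) => Y /and3P[outY eY sYX] minY.
exists (cut D Y); last by rewrite eY.
apply: (minimal_out_cut_is_cocycle outY eY) => Z outZ eZ sZY.
apply/eqP; rewrite eqEcard sZY minY // /P outZ eZ.
exact: subset_trans sYX.
Qed.

(** A directed cocycle with all edges at least [a] cannot be crossed backwards
    in [arc_relaxed D a]; conversely the set of vertices that the head of [e]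
    does not reach has only outgoing edges, all at least [a]. *)
Lemma mem_cocyclic_above D a e : (e \in cocyclic_above D a)
  = (e \in edges D) && ~~ connect (arc_relaxed D a) (head D e) (tail D e).
Proof.
apply/bigcupP/andP => [[B /andP[Bdir Bge] eB]|[eD not_back]].
  have /andP[_ /existsP[X /andP[/eqP defB /forall_inP dirB]]] := Bdir.
  move: Bge; rewrite (min_geE a eB) => /forall_inP Bge.
  split; first by move: eB; rewrite defB inE => /andP[].
  have /andP[teX heX] := dirB e eB.
  have stay u v : connect (arc_relaxed D a) u v -> u \notin X -> v \notin X.
    case/connectP => p; elim: p u => [u _ ->//|w p IH u /= /andP[uw wp] vl uX].
    apply: (IH w wp vl); case/exists_inP: uw => f fD.
    apply: contraL => wX; rewrite negb_or; apply/andP; split.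
      apply: contra uX => /andP[/eqP<- /eqP fw].
      apply: contraLR wX => tfX; rewrite -fw; apply/negP => hfX.
      have /dirB/andP[/(negP tfX)//] : f \in B.
      by rewrite defB mem_cut fD (negPf tfX) hfX.
    apply/and3P => -[fa /eqP fu /eqP fw].
    have /Bge : f \in B by rewrite defB mem_cut fD fu fw wX (negPf uX).
    by rewrite leNgt fa.
  by apply/negP => /stay /(_ heX); rewrite teX.
pose X := ~: [set v | connect (arc_relaxed D a) (head D e) v].
have outX : out_cut D X.
  apply/out_cutP => f fD; rewrite !inE; apply: contra => /connect_trans; apply.
  by apply/connect1/exists_inP; exists f; rewrite // !eqxx.
have eX : e \in cut D X by rewrite mem_cut eD !inE not_back connect0.
have [B Bdir /andP[eB /subsetP sBX]] := out_cut_cocycle outX eX.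
exists B => //; rewrite Bdir (min_geE a eB); apply/forall_inP => f /sBX.
rewrite mem_cut => /andP[fD]; rewrite leNgt; apply: contra => fa.
have [ht th] : arc_relaxed D a (head D f) (tail D f)
             /\ arc_relaxed D a (tail D f) (head D f).
  by split; apply/exists_inP; exists f; rewrite // ?fa !eqxx ?orbT.
suff -> : (tail D f \in X) = (head D f \in X) by [].
rewrite !inE; congr (~~ _).
by apply/idP/idP => /connect_trans; apply; apply: connect1.
Qed.

(** * Directed cycles as closed walks *)

(** The last clause is stated for arbitrary first and last edges because the
    path is closed into a cycle by one more edge, which plays both roles. *)
Lemma path_arcs D a u p : path (arc_above D a) u p ->
  exists s : seq E,
    [/\ all [pred e | (e \in edges D) && (a <= e)%O] s,
        [seq tail D e | e <- s] = belast u p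
      & forall e f, head D e = u -> tail D f = last u p ->
          path [rel e f | head D e == tail D f] e (rcons s f)].
Proof.
elim: p u => [|v p IH] u /=.
  by exists [::]; split=> // e f /= -> ->; rewrite eqxx.
case/andP=> /exists_inP[g gD /and3P[ag /eqP gu /eqP gv]] /IH[s [sD st s_path]].
exists (g :: s); rewrite /= gD ag gu st; split=> // e f eu fl.
by rewrite /= eu eqxx s_path.
Qed.

(** The edges of a shortest walk back from the head of [e] to its tail have
    pairwise distinct tails, so together with [e] they form a cycle. *)
Lemma mem_cyclic_above D a e : (e \in cyclic_above D a) =
  [&& e \in edges D, (a <= e)%O & connect (arc_above D a) (head D e) (tail D e)].
Proof.
apply/bigcupP/and3P => [[C /andP[Cdir Cge] eC]|[eD ae]].
  move: Cge; rewrite (min_geE a eC) => /forall_inP Cge.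
  case/existsP: Cdir => n /existsP[[c /= _] /andP[/and5P[_ cD c_cyc _]]].
  case/andP=> _ /eqP defC c_dir.
  have mem_c s : s \in c ->
      [/\ s.1 \in edges D, (a <= s.1)%O & s.2 = dir D s.1].
    move=> sc; have sC : s.1 \in C by rewrite defC inE map_f.
    by split; [exact: (allP cD) | exact: Cge | exact/eqP/(allP c_dir)].
  have [s sc def_e] : exists2 s, s \in c & e = s.1.
    by apply/mapP; move: eC; rewrite defC inE.
  have [sD sa sdir] := mem_c s sc; rewrite {e}def_e in eC *; split=> //.
  have walk p t : t.2 = dir D t.1 -> {subset p <= c} ->
      path [rel s t | ends D s.1 (~~ s.2) == ends D t.1 t.2] t (rcons p s) ->
      connect (arc_above D a) (head D t.1) (tail D s.1).
    elim: p t => [|r p IH] t tdir p_c /=.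
      by rewrite /head /tail tdir sdir andbT => /eqP->.
    have [rD ra rdir] := mem_c r (p_c r (mem_head _ _)).
    have /IH{}IH : {subset p <= c}.
      by move=> x xp; apply: p_c; rewrite inE xp orbT.
    case/andP=> /eqP tr /(IH r rdir); apply: connect_trans.
    apply/connect1/exists_inP; exists r.1; rewrite // ra eqxx andbT /=.
    by rewrite /head /tail -tdir -rdir tr.
  case: (rot_to sc) => i p def_p.
  apply: (walk p s sdir) => [t tp|].
    by rewrite -(mem_rot i) def_p inE tp orbT.
  by move: c_cyc; rewrite -(rot_cycle i) def_p.
case/connectP => p0 /shortenP[p p_path p_uniq _] p_last.
have [s [sD st s_path]] := path_arcs p_path.
pose c := [seq (f, dir D f) | f <- e :: s].
have c1 : [seq x.1 | x <- c] = e :: s by rewrite -map_comp map_id.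
have tails_uniq : uniq [seq tail D f | f <- e :: s].
  by rewrite /= st p_last -rcons_uniq -lastI.
have size_c : size c < #|E|.+1.
  by rewrite ltnS size_map -(card_uniqP (map_uniq tails_uniq)) max_card.
exists [set f in e :: s]; last by rewrite inE mem_head.
apply/andP; split; last first.
  rewrite (@min_geE _ a e) ?inE ?eqxx //.
  by apply/forall_inP => f; rewrite !inE => /predU1P[->//|/(allP sD)/andP[]].
apply/existsP; exists (Ordinal size_c); apply/existsP; exists (in_tuple c).
apply/andP; split; last by apply/allP => f /mapP[g _ ->] /=.
apply/and5P; split=> //.
- apply/allP => f /mapP[g + ->]; rewrite inE.
  by case/predU1P=> [->//|/(allP sD)/andP[]].
- rewrite /= -(map_rcons (fun f => (f, dir D f))) path_map.
  by apply: sub_path (s_path e e erefl p_last) => f g /=.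
- by rewrite -map_comp.
- by rewrite c1 eqxx (map_uniq tails_uniq).
Qed.

(** * Strong components *)

Definition strong (T : finType) (r : rel T) x y : bool :=
  connect r x y && connect r y x.

Lemma strongC (T : finType) (r : rel T) x y : strong r x y = strong r y x.
Proof. exact: andbC. Qed.

Lemma connect_sub_rev (T : finType) (r r' : rel T) :
    (forall x y, r x y -> connect r' y x) ->
  forall x y, connect r x y -> connect r' y x.
Proof.
move=> rr' x y; rewrite -[connect r' y x](connect_rev r' x y).
by apply: connect_sub => u v /rr'; rewrite connect_rev.
Qed.

(** Each step of a walk between two vertices of a strong component stays in this
    component, so only such steps have to be simulated. *)
Lemma strong_connect_sub (T : finType) (r r' : rel T) :
    (forall x y, r x y -> connect r y x -> connect r' x y) ->
  forall x y, strong r x y -> connect r' x y.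
Proof.
move=> rr' x y /andP[/connectP[p]].
elim: p x => [x _ -> //|z p IH x /= /andP[xz zp] y_last yx].
have zy : connect r z y by apply/connectP; exists p.
have zx := connect_trans zy yx.
apply: connect_trans (rr' _ _ xz zx) (IH z zp y_last _).
exact: connect_trans yx (connect1 xz).
Qed.

Lemma cyclic_above_strong D a e :
  e \in cyclic_above D a -> strong (arc_above D a) (head D e) (tail D e).
Proof.
rewrite mem_cyclic_above => /and3P[eD ae e_back]; rewrite /strong e_back.
by apply/connect1/exists_inP; exists e; rewrite // ae !eqxx.
Qed.

Lemma arc_relaxed_edge D a e :
  e \in edges D -> arc_relaxed D a (tail D e) (head D e).
Proof. by move=> eD; apply/exists_inP; exists e; rewrite // !eqxx. Qed.

Lemma arc_relaxed_back D a e :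
  e \in edges D -> (e < a)%O -> arc_relaxed D a (head D e) (tail D e).
Proof. by move=> eD ea; apply/exists_inP; exists e; rewrite // ea !eqxx orbT. Qed.

Lemma arc_above_edge D a e :
  e \in edges D -> (a <= e)%O -> arc_above D a (tail D e) (head D e).
Proof. by move=> eD ae; apply/exists_inP; exists e; rewrite // ae !eqxx. Qed.

Lemma not_cocyclic_above_strong D a e : e \in edges D ->
  (e \notin cocyclic_above D a) = strong (arc_relaxed D a) (head D e) (tail D e).
Proof.
move=> eD; rewrite mem_cocyclic_above eD negbK /strong.
by rewrite (connect1 (arc_relaxed_edge a eD)) andbT.
Qed.

Lemma cocyclic_above_edge D a e : e \in cocyclic_above D a -> e \in edges D.
Proof. by rewrite mem_cocyclic_above => /andP[]. Qed.

Lemma cocyclic_above_ge D a e : e \in cocyclic_above D a -> (a <= e)%O.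
Proof.
rewrite mem_cocyclic_above => /andP[eD]; rewrite leNgt; apply: contra => ea.
exact/connect1/arc_relaxed_back.
Qed.

Lemma cyclic_above_ge D a e : e \in cyclic_above D a -> (a <= e)%O.
Proof. by rewrite mem_cyclic_above => /and3P[]. Qed.

Lemma strong_mono (T : finType) (r r' : rel T) x y :
  subrel r r' -> strong r x y -> strong r' x y.
Proof.
move=> rr' /andP[xy yx]; apply/andP.
by split; [move: xy | move: yx]; apply: connect_sub => u v /rr'/connect1.
Qed.

Lemma arc_above_relaxed D a b : subrel (arc_above D a) (arc_relaxed D b).
Proof.
move=> x y /exists_inP[e eD /and3P[_ /eqP<- /eqP<-]]; exact: arc_relaxed_edge.
Qed.

Lemma arc_above_anti D a b : (a <= b)%O -> subrel (arc_above D b) (arc_above D a).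
Proof.
move=> ab x y /exists_inP[e eD /and3P[be /eqP<- /eqP<-]].
exact/arc_above_edge/(le_trans ab).
Qed.

Lemma arc_relaxed_mono D a b :
  (a <= b)%O -> subrel (arc_relaxed D a) (arc_relaxed D b).
Proof.
move=> ab x y /exists_inP[e eD /orP[/andP[]|/and3P[ea]] /eqP<- /eqP<-].
  exact: arc_relaxed_edge.
exact/arc_relaxed_back/(lt_le_trans ea).
Qed.

Lemma cyclic_above_anti D a b :
  (a <= b)%O -> cyclic_above D b \subset cyclic_above D a.
Proof.
move=> ab; apply/subsetP => e eb.
have := strong_mono (arc_above_anti ab) (cyclic_above_strong eb).
move: eb; rewrite !mem_cyclic_above => /and3P[-> be _] /andP[-> _].
by rewrite (le_trans ab be).
Qed.

Lemma cocyclic_above_anti D a b :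
  (a <= b)%O -> cocyclic_above D b \subset cocyclic_above D a.
Proof.
move=> ab; apply/subsetP => e eb; have eD := cocyclic_above_edge eb.
apply: contraLR eb; rewrite !not_cocyclic_above_strong //.
exact/strong_mono/arc_relaxed_mono.
Qed.

Lemma cyclic_cocyclic_disjoint D a b e :
  e \in cyclic_above D a -> e \notin cocyclic_above D b.
Proof.
move=> ea; rewrite not_cocyclic_above_strong.
  exact: strong_mono (@arc_above_relaxed D a b) (cyclic_above_strong ea).
by move: ea; rewrite mem_cyclic_above => /andP[].
Qed.

(** * Reversing one member of a family *)

Lemma tail_kept D A e : e \notin A -> tail (reorient D A) e = tail D e.
Proof. by rewrite /tail /= ffunE => /negPf->. Qed.

Lemma head_kept D A e : e \notin A -> head (reorient D A) e = head D e.
Proof. by rewrite /head /= ffunE => /negPf->. Qed.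

Lemma tail_reversed D A e : e \in A -> tail (reorient D A) e = head D e.
Proof. by rewrite /tail /head /= ffunE => ->. Qed.

Lemma head_reversed D A e : e \in A -> head (reorient D A) e = tail D e.
Proof. by rewrite /tail /head /= ffunE => ->; rewrite negbK. Qed.

Lemma reorientK D A : reorient (reorient D A) A = D.
Proof.
by case: D => G o; congr Digraph; apply/ffunP => e; rewrite !ffunE addKb.
Qed.

Lemma reorient0 D : reorient D set0 = D.
Proof. by case: D => G o; congr Digraph; apply/ffunP => e; rewrite ffunE inE. Qed.

Lemma reorient_setD D A B :
  B \subset A -> reorient D (A :\: B) = reorient (reorient D A) B.
Proof.
move=> /subsetP sBA; congr Digraph; apply/ffunP => e; rewrite !ffunE inE.
by case: (boolP (e \in B)) => //= /sBA->; rewrite addTb negbK.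
Qed.

Lemma reorient_setU D A B :
  [disjoint A & B] -> reorient D (A :|: B) = reorient (reorient D A) B.
Proof.
move=> dAB; congr Digraph; apply/ffunP => e; rewrite !ffunE inE.
by case: (boolP (e \in A)) => //= eA; rewrite (disjointFr dAB eA).
Qed.

Lemma reorient_dir_inj D A B : dir (reorient D A) = dir (reorient D B) -> A = B.
Proof.
by move/ffunP=> eqAB; apply/setP => e; have := eqAB e; rewrite !ffunE => /addIb.
Qed.

(** Digraphs related in this way have the same active filtration, active
    partition, active and dual-active edges. *)
Definition same_unions D D' : Prop :=
  [/\ ugraph D = ugraph D', forall b, cocyclic_above D b = cocyclic_above D' b
    & forall b, cyclic_above D b = cyclic_above D' b].

Section ReorientCocyclic.
Variables (D : digraph V E) (a : E).
Let A := cocyclic_above D a.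
Let H := reorient D A.

Let strong_ends b e : e \in edges D ->
  strong (arc_relaxed H b) (head H e) (tail H e)
    = strong (arc_relaxed H b) (head D e) (tail D e).
Proof.
move=> eD; have [eA|eA] := boolP (e \in A).
  by rewrite head_reversed ?tail_reversed // strongC.
by rewrite head_kept ?tail_kept.
Qed.

(* For [b <= a] an edge inside a strong component is not in [A], so it keeps its
   direction. *)
Let strong_below b x y : (b <= a)%O ->
  strong (arc_relaxed D b) x y -> strong (arc_relaxed H b) x y.
Proof.
move=> ba; suff keep u v :
    strong (arc_relaxed D b) u v -> connect (arc_relaxed H b) u v.
  by move=> xy; rewrite /strong !keep // strongC.
apply: strong_connect_sub => {x y u v} x y xy yx.
have yx_strong : strong (arc_relaxed D b) y x by rewrite /strong yx connect1.
apply: connect1; case/exists_inP: xy => e eD e_xy; apply/exists_inP; exists e => //.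
have eA : e \notin A.
  apply: contra (subsetP (cocyclic_above_anti D ba) e) _.
  rewrite not_cocyclic_above_strong //.
  by case/orP: e_xy => [/andP[]|/and3P[_]] /eqP-> /eqP->; rewrite // strongC.
by rewrite tail_kept ?head_kept.
Qed.

(* For [a <= b] all walks can be turned around: the edges of [A] are reversed,
   and the others lie inside strong components for [a], which are still strongly
   connected. *)
Let reverse_above b x y : (a <= b)%O ->
  connect (arc_relaxed D b) x y -> connect (arc_relaxed H b) y x.
Proof.
move=> ab; apply: connect_sub_rev => {x y} x y /exists_inP[e eD e_xy].
have [eA|eA] := boolP (e \in A).
  have ae := cocyclic_above_ge eA.
  case/orP: e_xy => [/andP[]|/and3P[eb]] /eqP<- /eqP<-; apply: connect1.
    by rewrite -(tail_reversed D eA) -(head_reversed D eA); apply: arc_relaxed_edge.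
  by rewrite -(tail_reversed D eA) -(head_reversed D eA); apply: arc_relaxed_back.
have : strong (arc_relaxed D a) (head D e) (tail D e).
  by rewrite -not_cocyclic_above_strong.
move/(strong_below (lexx a))/(strong_mono (arc_relaxed_mono ab))/andP.
by case/orP: e_xy => [/andP[]|/and3P[_]] /eqP<- /eqP<- [].
Qed.

Lemma cocyclic_above_reorient_cocyclic_sub b :
  cocyclic_above H b \subset cocyclic_above D b.
Proof.
apply/subsetP => e eH; have eD : e \in edges D := cocyclic_above_edge eH.
apply: contraLR eH; rewrite !not_cocyclic_above_strong // strong_ends // => e_strong.
have [ba|/ltW ab] := leP b a; first exact: strong_below.
by have /andP[ht th] := e_strong; rewrite /strong !reverse_above.
Qed.

(** Walks of the reversed digraph can be turned around too, since the edges of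
    [A] are at least [a] and so are used in one direction only. *)
Lemma cocyclic_above_reorient_cocyclic : cocyclic_above H a = A.
Proof.
apply/eqP; rewrite eqEsubset cocyclic_above_reorient_cocyclic_sub; apply/subsetP => e eA.
have eD : e \in edges D := cocyclic_above_edge eA.
suff back x y : connect (arc_relaxed H a) x y -> connect (arc_relaxed D a) y x.
  rewrite mem_cocyclic_above eD head_reversed ?tail_reversed //=; apply/negP => /back.
  by move: eA; rewrite mem_cocyclic_above eD => /negP.
apply: connect_sub_rev => {x y} x y /exists_inP[f fD f_xy].
have [fA|fA] := boolP (f \in A).
  have := cocyclic_above_ge fA; rewrite leNgt => /negPf fa.
  move: f_xy; rewrite fa orbF tail_reversed ?head_reversed // => /andP[/eqP<- /eqP<-].
  exact/connect1/arc_relaxed_edge.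
move: f_xy; rewrite tail_kept ?head_kept //.
have : strong (arc_relaxed D a) (head D f) (tail D f).
  by rewrite -not_cocyclic_above_strong.
by move=> /andP[? ?] /orP[/andP[]|/and3P[_]] /eqP<- /eqP<-.
Qed.

(** A directed cycle shares no edge with [A], so it survives. *)
Lemma cyclic_above_reorient_cocyclic_sub b :
  cyclic_above D b \subset cyclic_above H b.
Proof.
apply/subsetP => e eb; have eA := cyclic_cocyclic_disjoint a eb.
have := cyclic_above_strong eb; move: eb; rewrite !mem_cyclic_above.
move=> /and3P[-> -> _] e_strong; rewrite head_kept ?tail_kept //=.
apply: strong_connect_sub e_strong => x y /exists_inP[f fD].
case/and3P=> bf /eqP<- /eqP<- f_back; have fA : f \notin A.
  by apply: (@cyclic_cocyclic_disjoint _ b); rewrite mem_cyclic_above fD bf.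
by rewrite -(tail_kept D fA) -(head_kept D fA); apply/connect1/arc_above_edge.
Qed.

End ReorientCocyclic.

(** The inclusions proved above are applied twice, to [D] and to the reversed
    digraph, whose reversal at the same index is [D] again. *)
Lemma same_unions_reorient_cocyclic D a :
  same_unions (reorient D (cocyclic_above D a)) D.
Proof.
set A := cocyclic_above D a; set H := reorient D A.
have HA : reorient H (cocyclic_above H a) = D.
  by rewrite cocyclic_above_reorient_cocyclic reorientK.
split=> // b; apply/eqP; rewrite eqEsubset.
  rewrite cocyclic_above_reorient_cocyclic_sub.
  by have := cocyclic_above_reorient_cocyclic_sub H a b; rewrite HA.
rewrite cyclic_above_reorient_cocyclic_sub andbT.
by have := cyclic_above_reorient_cocyclic_sub H a b; rewrite HA.
Qed.

Section ReorientCyclic.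
Variables (D : digraph V E) (a : E).
Let A := cyclic_above D a.
Let H := reorient D A.

(* For [a <= b] the walks inside a strong component only use edges of [A], so
   they are turned around. *)
Let cyclic_sub_above b : (a <= b)%O -> cyclic_above D b \subset cyclic_above H b.
Proof.
move=> ab; apply/subsetP => e eb.
have eA := subsetP (cyclic_above_anti D ab) e eb.
have := cyclic_above_strong eb; move: eb; rewrite !mem_cyclic_above.
move=> /and3P[eD be _] e_strong.
rewrite /= eD be head_reversed ?tail_reversed //=.
rewrite -[connect _ _ _](connect_rev (arc_above H b)).
apply: strong_connect_sub e_strong => x y /exists_inP[f fD].
case/and3P=> bf /eqP<- /eqP<- f_back; apply: connect1.
have fA : f \in A.
  by apply: (subsetP (cyclic_above_anti D ab)); rewrite mem_cyclic_above fD bf.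
by rewrite /= -(head_reversed D fA) -(tail_reversed D fA); apply: arc_above_edge.
Qed.

(* For [b <= a] a reversed edge can be replaced by a walk inside its strong
   component. *)
Let connect_below b x y : (b <= a)%O ->
  connect (arc_above D b) x y -> connect (arc_above H b) x y.
Proof.
move=> ba; apply: connect_sub => {x y} x y /exists_inP[e eD].
case/and3P=> be /eqP<- /eqP<-.
have [eA|eA] := boolP (e \in A); last first.
  by rewrite -(tail_kept D eA) -(head_kept D eA); apply/connect1/arc_above_edge.
have := cyclic_above_strong (subsetP (cyclic_sub_above (lexx a)) e eA).
by rewrite head_reversed ?tail_reversed // => /(strong_mono (arc_above_anti ba))/andP[].
Qed.

Lemma cyclic_above_reorient_cyclic_sub b :
  cyclic_above D b \subset cyclic_above H b.
Proof.
have [ba|/ltW ab] := leP b a; last exact: cyclic_sub_above.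
apply/subsetP => e eb; have [eA|eA] := boolP (e \in A).
  exact/(subsetP (cyclic_above_anti H ba))/(subsetP (cyclic_sub_above (lexx a))).
move: eb; rewrite !mem_cyclic_above head_kept ?tail_kept // => /and3P[-> -> /=].
exact: connect_below.
Qed.

Lemma cyclic_above_reorient_cyclic : cyclic_above H a = A.
Proof.
apply/eqP; rewrite eqEsubset cyclic_sub_above // andbT.
apply/subsetP => e; have [//|eA] := boolP (e \in A); move: (eA).
rewrite !mem_cyclic_above head_kept ?tail_kept // => /negP e_out.
case/and3P=> eD ae e_back; case: e_out; rewrite eD ae /=; apply: connect_sub e_back => x y.
case/exists_inP=> f fD /and3P[af /eqP<- /eqP<-].
have [fA|fA] := boolP (f \in A).
  rewrite tail_reversed ?head_reversed //.
  by have /andP[] := cyclic_above_strong fA.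
by rewrite tail_kept ?head_kept //; apply/connect1/arc_above_edge.
Qed.

Lemma cocyclic_above_reorient_cyclic_sub b :
  cocyclic_above H b \subset cocyclic_above D b.
Proof.
apply/subsetP => e; have [eA|eA] := boolP (e \in A).
  apply: contraLR => _; apply: (@cyclic_cocyclic_disjoint _ a).
  exact: (subsetP (cyclic_sub_above (lexx a))).
rewrite !mem_cocyclic_above head_kept ?tail_kept // => /andP[-> /=].
apply: contra.
apply: connect_sub => x y /exists_inP[f fD f_xy].
have [fA|fA] := boolP (f \in A).
  have := cyclic_above_strong (subsetP (cyclic_sub_above (lexx a)) f fA).
  move/(strong_mono (@arc_above_relaxed H a b)).
  rewrite head_reversed ?tail_reversed //.
  by case/andP=> ? ?; case/orP: f_xy => [/andP[]|/and3P[_]] /eqP<- /eqP<-.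
by apply/connect1/exists_inP; exists f; rewrite // tail_kept ?head_kept.
Qed.

End ReorientCyclic.

Lemma same_unions_reorient_cyclic D a :
  same_unions (reorient D (cyclic_above D a)) D.
Proof.
set A := cyclic_above D a; set H := reorient D A.
have HA : reorient H (cyclic_above H a) = D.
  by rewrite cyclic_above_reorient_cyclic reorientK.
split=> // b; apply/eqP; rewrite eqEsubset.
  rewrite cocyclic_above_reorient_cyclic_sub.
  by have := cocyclic_above_reorient_cyclic_sub H a b; rewrite HA.
rewrite cyclic_above_reorient_cyclic_sub andbT.
by have := cyclic_above_reorient_cyclic_sub H a b; rewrite HA.
Qed.

(** * Filtrations of decreasing families *)

(** For the families [cocyclic_above D] and [cyclic_above D] these are the
    dual-active and the active edges. *)
Definition minima (f : E -> {set E}) : seq E :=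
  sort <=%O (enum [set a | a \in f a]).

Definition chain (f : E -> {set E}) k : {set E} :=
  nth set0 [seq f a | a <- minima f] k.

Definition layer (f : E -> {set E}) k : {set E} := chain f k :\: chain f k.+1.

Lemma chain_default (f : E -> {set E}) k :
  size (minima f) <= k -> chain f k = set0.
Proof. by move=> ?; rewrite /chain nth_default ?size_map. Qed.

Lemma eq_minima (f g : E -> {set E}) : f =1 g -> minima f = minima g.
Proof.
by move=> fg; congr sort; apply: eq_enum => a; rewrite !inE fg.
Qed.

Lemma eq_chain (f g : E -> {set E}) : f =1 g -> chain f =1 chain g.
Proof. by move=> fg k; rewrite /chain (eq_minima fg) (eq_map fg). Qed.

Lemma chainP (f : E -> {set E}) k :
  chain f k = set0 \/ exists a, chain f k = f a.
Proof.
rewrite /chain; elim: (minima f) k => [|a s IH] [|k] /=; try by left.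
  by right; exists a.
exact: IH.
Qed.

Section Chains.
Variable f : E -> {set E}.
Hypothesis f_anti : forall a b, (a <= b)%O -> f b \subset f a.
Hypothesis f_ge : forall a e, e \in f a -> (a <= e)%O.

Lemma chain_anti j k : j <= k -> chain f k \subset chain f j.
Proof.
move=> jk; have [k_large|k_lt] := leqP (size (minima f)) k.
  by rewrite chain_default ?sub0set.
have a : E by case: (minima f) k_lt => [|a].
rewrite /chain !(nth_map a) ?(leq_ltn_trans jk) //; apply: f_anti.
by apply: sorted_leq_nth; rewrite ?inE ?(leq_ltn_trans jk) ?sort_le_sorted //;
  apply: le_trans.
Qed.

Lemma layer_inj e j k : e \in layer f j -> e \in layer f k -> j = k.
Proof.
have lt_absurd i l : i < l -> e \in layer f i -> e \in layer f l -> False.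
  move=> il; rewrite !inE => /andP[/negP e_i _] /andP[_ e_l].
  by apply: e_i; apply: (subsetP (chain_anti il)).
by move=> ej ek; case: (ltngtP j k) => // jk; case: (lt_absurd _ _ jk).
Qed.

Lemma layer_neq0 k : k < size (minima f) -> layer f k != set0.
Proof.
move=> k_lt; have a : E by case: (minima f) k_lt => [|a].
(* The index of a member lies in it, but not in the next one. *)
pose m := nth a (minima f) k; apply/set0Pn; exists m.
have : m \in minima f by apply: mem_nth.
rewrite mem_sort mem_enum !inE {2}/chain (nth_map a) // => ->; rewrite andbT.
have [k_last|k1_lt] := leqP (size (minima f)) k.+1.
  by rewrite chain_default ?inE.
rewrite /chain (nth_map a) //; apply/negP => /f_ge; rewrite leNgt => /negP; apply.
have minima_sorted : sorted <%O (minima f) by rewrite sort_lt_sorted enum_uniq.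
by apply: (sorted_ltn_nth _ _ minima_sorted); rewrite ?inE //; apply: lt_trans.
Qed.

Lemma card_layers n : n = size (minima f) -> #|[set layer f k | k : 'I_n]| = n.
Proof.
move=> ->; rewrite card_imset ?card_ord // => j k eq_jk; apply: val_inj.
have /set0Pn[e ej] := layer_neq0 (ltn_ord j).
by apply: (@layer_inj e) => //; rewrite -eq_jk.
Qed.

End Chains.

(** * The active partition *)

Lemma dual_activeE D : dual_active D = minima (cocyclic_above D).
Proof.
congr sort; apply: eq_enum => a; rewrite !inE.
apply/existsP/bigcupP => [[B /andP[Bdir a_min]]|[B /andP[Bdir B_ge] aB]].
  have /andP[aB _] := a_min; exists B => //; rewrite Bdir.
  by apply/existsP; exists a; rewrite a_min lexx.
by exists B; rewrite Bdir /is_min aB -(min_geE a aB).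
Qed.

Lemma activeE D : active D = minima (cyclic_above D).
Proof.
congr sort; apply: eq_enum => a; rewrite !inE.
apply/existsP/bigcupP => [[C /andP[Cdir a_min]]|[C /andP[Cdir C_ge] aC]].
  have /andP[aC _] := a_min; exists C => //; rewrite Cdir.
  by apply/existsP; exists a; rewrite a_min lexx.
by exists C; rewrite Cdir /is_min aC -(min_geE a aC).
Qed.

Lemma dual_filtrationE D k :
  dual_filtration D k = edges D :\: chain (cocyclic_above D) k.
Proof.
rewrite /dual_filtration /chain dual_activeE.
by elim: (minima _) k => [|a s IH] [|k] //=; rewrite ?setD0.
Qed.

Lemma cyclic_filtrationE D k : cyclic_filtration D k = chain (cyclic_above D) k.
Proof. by rewrite /cyclic_filtration activeE. Qed.

Lemma cyclic_partE D : cyclic_part D = \bigcup_a cyclic_above D a.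
Proof.
apply/setP => e; apply/bigcupP/bigcupP => [[C Cdir eC]|[a _ /bigcupP[C]]].
  have [m m_min] := exists_min eC; exists m => //; apply/bigcupP; exists C => //.
  by rewrite Cdir; apply/existsP; exists m; rewrite m_min lexx.
by case/andP=> Cdir _ eC; exists C.
Qed.

Lemma dual_layerE D k : dual_filtration D k.+1 :\: dual_filtration D k
  = layer (cocyclic_above D) k.
Proof.
have sub_edges : chain (cocyclic_above D) k \subset edges D.
  case: (chainP (cocyclic_above D) k) => [->|[a ->]]; first exact: sub0set.
  by apply/subsetP => e; apply: cocyclic_above_edge.
apply/setP => e; rewrite !dual_filtrationE !inE.
have := subsetP sub_edges e; case: (e \in edges D) => [_|/contraFF->//].
by rewrite !andbT negbK andbC.
Qed.

Lemma cyclic_layerE D k : cyclic_filtration D k :\: cyclic_filtration D k.+1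
  = layer (cyclic_above D) k.
Proof. by rewrite !cyclic_filtrationE. Qed.

Lemma mem_active_parts D P : reflect
  ((exists2 k, k < dual_activity D & P = layer (cocyclic_above D) k) \/
   (exists2 k, k < activity D & P = layer (cyclic_above D) k))
  (P \in active_parts D).
Proof.
rewrite inE; apply: (iffP orP) => -[].
- by case/imsetP => k _ ->; left; exists k; rewrite // dual_layerE.
- by case/imsetP => k _ ->; right; exists k; rewrite // cyclic_layerE.
- case=> k k_lt ->; left; apply/imsetP.
  by exists (Ordinal k_lt); rewrite // dual_layerE.
case=> k k_lt ->; right; apply/imsetP.
by exists (Ordinal k_lt); rewrite // cyclic_layerE.
Qed.

Lemma layers_disjoint D e j k : e \in layer (cyclic_above D) j ->
  e \notin layer (cocyclic_above D) k.
Proof.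
rewrite !inE => /andP[_ ej]; rewrite negb_and; apply/orP; right.
case: (chainP (cocyclic_above D) k) => [->|[b ->]]; first by rewrite inE.
case: (chainP (cyclic_above D) j) ej => [->|[a ->]]; first by rewrite inE.
exact: cyclic_cocyclic_disjoint.
Qed.

Lemma active_part_unique D P P' e : P \in active_parts D -> P' \in active_parts D ->
  e \in P -> e \in P' -> P = P'.
Proof.
move=> /mem_active_parts[] [j _ ->] /mem_active_parts[] [k _ ->] ej ek.
- by congr layer; apply: (layer_inj (@cocyclic_above_anti D)) ej ek.
- by have := layers_disjoint j ek; rewrite ej.
- by have := layers_disjoint k ej; rewrite ek.
- by congr layer; apply: (layer_inj (@cyclic_above_anti D)) ej ek.
Qed.

Lemma active_part_neq0 D P : P \in active_parts D -> P != set0.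
Proof.
case/mem_active_parts => -[k]; rewrite /dual_activity /activity.
  rewrite dual_activeE => k_lt ->.
  exact: (layer_neq0 (@cocyclic_above_ge D)).
rewrite activeE => k_lt ->; exact: (layer_neq0 (@cyclic_above_ge D)).
Qed.

Lemma active_partsE D : active_parts D =
  [set layer (cocyclic_above D) k | k : 'I_(dual_activity D)]
  :|: [set layer (cyclic_above D) k | k : 'I_(activity D)].
Proof.
by congr (_ :|: _); apply: eq_imset => k; rewrite (dual_layerE, cyclic_layerE).
Qed.

Lemma card_active_parts D : #|active_parts D| = dual_activity D + activity D.
Proof.
rewrite active_partsE cardsU.
rewrite (card_layers (@cocyclic_above_anti D) (@cocyclic_above_ge D));
  last by rewrite /dual_activity dual_activeE.
rewrite (card_layers (@cyclic_above_anti D) (@cyclic_above_ge D));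
  last by rewrite /activity activeE.
rewrite disjoint_setI0 ?cards0 ?subn0 //; apply/pred0P => P /=.
apply/negP => /andP[/imsetP[j _ defP] /imsetP[k _ defP']].
have /active_part_neq0/set0Pn[e eP] : P \in active_parts D.
  by apply/mem_active_parts; left; exists j; rewrite ?ltn_ord.
have : e \in layer (cyclic_above D) k by rewrite -defP'.
by move/layers_disjoint => /(_ j); rewrite -defP eP.
Qed.

Lemma cover_active_parts_inj D :
  {in powerset (active_parts D) &, injective (@cover E)}.
Proof.
suff sub (Q R : {set {set E}}) :
    Q \subset active_parts D -> R \subset active_parts D ->
    cover Q = cover R -> Q \subset R.
  move=> Q R; rewrite !inE => QD RD eqQR.
  by apply/eqP; rewrite eqEsubset; apply/andP; split; apply: sub.
move=> /subsetP QD /subsetP RD eqQR; apply/subsetP => P PQ.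
have /set0Pn[e eP] := active_part_neq0 (QD P PQ).
have : e \in cover R by rewrite -eqQR; apply/bigcupP; exists P.
case/bigcupP => P' P'R eP'.
by rewrite (active_part_unique (QD P PQ) (RD P' P'R) eP eP').
Qed.

(** * Reversing a union of parts *)

Section SameUnions.
Variables D D' : digraph V E.
Hypothesis same : same_unions D D'.

Lemma same_dual_active : dual_active D = dual_active D'.
Proof. by rewrite !dual_activeE; apply: eq_minima; case: same. Qed.

Lemma same_active : active D = active D'.
Proof. by rewrite !activeE; apply: eq_minima; case: same. Qed.

Lemma same_dual_filtration : dual_filtration D =1 dual_filtration D'.
Proof.
case: same => eqG eqU _ k.
by rewrite !dual_filtrationE eqG (eq_chain eqU).
Qed.

Lemma same_cyclic_filtration : cyclic_filtration D =1 cyclic_filtration D'.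
Proof. by case: same => _ _ eqW k; rewrite !cyclic_filtrationE (eq_chain eqW). Qed.

Lemma same_cyclic_part : cyclic_part D = cyclic_part D'.
Proof. by rewrite !cyclic_partE; apply: eq_bigr => a _; case: same. Qed.

Lemma same_active_filtration : active_filtration D = active_filtration D'.
Proof.
rewrite /active_filtration /activity /dual_activity same_cyclic_part.
rewrite same_active same_dual_active.
by rewrite (eq_mkseq same_cyclic_filtration) (eq_mkseq same_dual_filtration).
Qed.

Lemma same_active_parts : active_parts D = active_parts D'.
Proof.
rewrite /active_parts /activity /dual_activity same_active same_dual_active.
by congr (_ :|: _); apply: eq_imset => k;
  rewrite ?same_dual_filtration ?same_cyclic_filtration.
Qed.

End SameUnions.

Lemma same_unions_trans D D' D'' :
  same_unions D D' -> same_unions D' D'' -> same_unions D D''.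
Proof.
move=> [eqG eqU eqW] [eqG' eqU' eqW'].
by split=> [|a|a]; rewrite ?eqG ?eqU ?eqW.
Qed.

Lemma same_unions_reorient_cocyclic_chain D k :
  same_unions (reorient D (chain (cocyclic_above D) k)) D.
Proof.
case: (chainP (cocyclic_above D) k) => [->|[a ->]]; first by rewrite reorient0.
exact: same_unions_reorient_cocyclic.
Qed.

Lemma same_unions_reorient_cyclic_chain D k :
  same_unions (reorient D (chain (cyclic_above D) k)) D.
Proof.
case: (chainP (cyclic_above D) k) => [->|[a ->]]; first by rewrite reorient0.
exact: same_unions_reorient_cyclic.
Qed.

(** A part is the difference of two consecutive members of a filtration.  After
    the first one is reversed the second one still is a member of the
    filtration, so it can be reversed as well. *)
Lemma same_unions_reorient_part D P :
  P \in active_parts D -> same_unions (reorient D P) D.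
Proof.
case/mem_active_parts => -[k _ ->]; rewrite /layer reorient_setD.
- have same := same_unions_reorient_cocyclic_chain D k.
  have [_ eqU _] := same; rewrite -(eq_chain eqU k.+1).
  exact: same_unions_trans (same_unions_reorient_cocyclic_chain _ _) same.
- exact: (chain_anti (@cocyclic_above_anti D)).
- have same := same_unions_reorient_cyclic_chain D k.
  have [_ _ eqW] := same; rewrite -(eq_chain eqW k.+1).
  exact: same_unions_trans (same_unions_reorient_cyclic_chain _ _) same.
- exact: (chain_anti (@cyclic_above_anti D)).
Qed.

Lemma same_unions_reorient_cover D (Q : {set {set E}}) :
  Q \subset active_parts D -> same_unions (reorient D (cover Q)) D.
Proof.
move: {2}#|Q| (leqnn #|Q|) => n; elim: n D Q => [|n IH] D Q leQn QD.
  move: leQn; rewrite leqn0 cards_eq0 => /eqP->.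
  by rewrite /cover big_set0 reorient0.
have [->|/set0Pn[P PQ]] := eqVneq Q set0.
  by rewrite /cover big_set0 reorient0.
have PD := subsetP QD P PQ; have same := same_unions_reorient_part PD.
rewrite /cover (big_setD1 P PQ) reorient_setU; last first.
  apply/pred0P => e /=; apply/negP => /andP[eP /bigcupP[P']].
  rewrite !inE => /andP[P'P P'Q] eP'; case/eqP: P'P.
  exact: active_part_unique (subsetP QD P' P'Q) PD eP' eP.
apply: (same_unions_trans _ same); apply: IH.
  by move: leQn; rewrite (cardsD1 P Q) PQ.
rewrite (same_active_parts same); apply: subset_trans QD; exact: subsetDl.
Qed.

Lemma mem_cover_active_parts D (Q : {set {set E}}) P :
    Q \subset active_parts D -> P \in active_parts D ->
  {in P, forall e, (e \in cover Q) = (P \in Q)}.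
Proof.
move=> /subsetP QD PD e eP.
apply/bigcupP/idP => [[P' P'Q eP']|PQ]; last by exists P.
by rewrite (active_part_unique PD (QD P' P'Q) eP eP').
Qed.

Lemma same_up_to_opposite_reorient (U : finType) (M M' : digraph U E) (b : bool) :
    ugraph M = ugraph M' ->
    {in edges M', forall e, dir M e = b (+) dir M' e} ->
  same_up_to_opposite M M'.
Proof.
by move=> eqG eqdir; case: b eqdir => eqdir; [right | left];
  split; rewrite ?eqG //= => e eM; split=> //; rewrite eqdir // ffunE eM.
Qed.

End Unions.

Theorem proposition3p16 (d : Order.disp_t) (V : finType) (E : finOrderType d)
    (G : digraph V E) (hconn : connected G) :
  #|[set dir (reorient G (cover Q)) | Q in powerset (active_parts G)]|
    = 2 ^ (dual_activity G + activity G) /\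
  forall Q : {set {set E}}, Q \subset active_parts G ->
  let H := reorient G (cover Q) in
  [/\ active_filtration H = active_filtration G,
      active_partition H = active_partition G,
      dual_active H = dual_active G /\ active H = active G,
      (forall k : nat, k < dual_activity G ->
         same_up_to_opposite (dual_active_minor H k) (dual_active_minor G k)) &
      (forall k : nat, k < activity G ->
         same_up_to_opposite (cyclic_active_minor H k)
                             (cyclic_active_minor G k))].
Proof.
split=> [|Q QG H].
  rewrite card_in_imset ?card_powerset ?card_active_parts // => Q R QG RG.
  by move/reorient_dir_inj/(cover_active_parts_inj QG RG).
have same : same_unions H G := same_unions_reorient_cover QG.
have dirH X : X \in active_parts G ->
    {in X, forall e, dir H e = (X \in Q) (+) dir G e}.
  by move=> XG e eX; rewrite ffunE (mem_cover_active_parts QG XG).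
split; first exact: same_active_filtration.
- by rewrite /active_partition (same_active_parts same) (same_cyclic_part same).
- by rewrite (same_dual_active same) (same_active same).
- move=> k k_lt; rewrite /dual_active_minor !(same_dual_filtration same).
  have XG : layer (cocyclic_above G) k \in active_parts G.
    by apply/mem_active_parts; left; exists k.
  apply: (same_up_to_opposite_reorient (b := layer (cocyclic_above G) k \in Q)) => //= e.
  rewrite !inE => /and3P[e_k _ e_k1]; apply: (dirH _ XG).
  by rewrite -dual_layerE inE e_k.
move=> k k_lt; rewrite /cyclic_active_minor !(same_cyclic_filtration same).
have XG : layer (cyclic_above G) k \in active_parts G.
  by apply/mem_active_parts; right; exists k.
apply: (same_up_to_opposite_reorient (b := layer (cyclic_above G) k \in Q)) => //= e.
rewrite !inE => /and3P[e_k1 _ e_k]; apply: (dirH _ XG).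
by rewrite -cyclic_layerE inE e_k1.
Qed.
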